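(* The framework described in the context can also be extended to more general cases, for example when the cost for each individual agent depends not only on the $\ell_1$-norm of the changes but also on the agent itself (it might be much more difficult to get some agents to cooperate than others). This can be modeled by a cost function of the form $\mathrm{cost}(p')=\sum_{v\in V}\sum_{u\in N(v)}\lambda_v|p_v(u)-p'_v(u)|$, where $\lambda_v$ is a constant that depends on the agent $v$. Such a cost function can be encoded in the framework by multiplying the objective of each linear program $LP_v(v_{j_1},\dots,v_{j_k})$ by $\lambda_v$.
   Context: Setting. Let $G=(V,E)$ be a simple undirected graph with positive integer capacities $q(v)$, $v\in V$. $N(v)$ is the set of neighbours of $v$, $E(v)$ the set of edges incident to $v$, and for $M\subseteq E$, $M(v)=M\cap E(v)$. $M$ is a $q$-matching if $|M(v)|\le q(v)$ for all $v$; it is maximal if no further edge can be added; $v$ is saturated if $|M(v)|=q(v)$. Each agent $v$ assigns a nonnegative real number $p_v(u)=p_v(uv)$ to each $u\in N(v)$ (higher is better; ties allowed). $M$ is weakly stable with respect to $p$ if there is no edge $uv\in E\setminus M$ such that each of $u$ and $v$ either is unsaturated or strictly prefers the other to some of its partners in $M$. Problems. In $\ell_1$-MIN-PM, given a maximal $q$-matching $M$ and preference values $p$, the goal is to find preferences $p'$ of minimum cost such that $M$ is weakly stable with respect to $p'$, where the cost is $\sum_{v\in V}\sum_{u\in N(v)}|p_v(u)-p'_v(u)|$. In the more general $\ell_1$-MIN-PMRI, nonnegative bounds $\ell_v(e),u_v(e)$ are also given and $p'$ must satisfy $\ell_v(e)\le p'_v(e)\le u_v(e)$ for each $v\in V$,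 $e\in E(v)$. Framework. If bounds are given, first replace every $p_v(e)$ below $\ell_v(e)$ by $\ell_v(e)$ and every $p_v(e)$ above $u_v(e)$ by $u_v(e)$. Delete all edges outside $M$ that do not block $M$. For each vertex $v$, order the edges of $E(v)\setminus M(v)$ as $e^v_1,e^v_2,\dots$ and create a copy $v_j$ of $v$ for each $e^v_j$. The auxiliary graph $H$ on all copies has an edge $u_iv_j$ exactly when $uv\in E\setminus M$ and $uv=e^u_i=e^v_j$ (so $H$ is a perfect matching). For each saturated $v$ and each set $\{v_{j_1},\dots,v_{j_k}\}$ of its copies, let $LP_v(v_{j_1},\dots,v_{j_k})$ be the (linearizable) program: minimize $\sum_{e\in E(v)}|x(e)-p_v(e)|$ subject to $0\le x(e^v_{j_i})\le\min_{e\in M(v)}x(e)$ for $1\le i\le k$ and, if bounds are given, also $0\le x(e)\le u_v(e)$ for $e\in M(v)$ and $\ell_v(e)\le x(e)$ for $e\in E(v)\setminus M(v)$. Its optimum is the minimum cost of dominating $e^v_{j_1},\dots,e^v_{j_k}$ at $v$. For a set $X$ of copies, let $f_v(X)$ be $0$ if $X$ contains no copy of $v$; otherwise let it be the optimum of the program for the copies of $v$ in $X$ if $v$ is saturated, and $+\infty$ if $v$ is unsaturated. Put $c(X)=\sum_{v\in V}f_v(X)$. The function $c$ is submodular, and the modification problem is equivalent to finding a minimum $c$-cost vertex cover of $H$. If $G$ is bipartite, the copies can be placed so that $c$ is a sum of two submodular functions, one on each side of $H$, and then the vertex cover problem is solvable in polynomial time; for general $G$ it admits a polynomial-time 2-approximation.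 *)

(* Defs.v *)
From mathcomp Require Import all_boot all_order all_algebra.
From mathcomp Require Import all_classical all_reals ereal.

Set Implicit Arguments.
Unset Strict Implicit.
Unset Printing Implicit Defensive.

Import Order.TTheory GRing.Theory Num.Theory.
Local Open Scope ring_scope.

(** * Graphs and q-matchings *)

(* An edge is the set of its two endpoints; a graph on [V] is its edge set. *)
Definition simple_graph (V : finType) (E : {set {set V}}) : Prop :=
  forall e, e \in E -> #|e| = 2%N.

Definition nbr (V : finType) (E : {set {set V}}) (v : V) : {set V} :=
  [set u | [set u; v] \in E].

(* [incident F v] is F(v), for F a set of edges. *)
Definition incident (V : finType) (F : {set {set V}}) (v : V) :
  {set {set V}} := [set e in F | v \in e].

Definition q_matching (V : finType) (E : {set {set V}}) (q : V -> nat)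
    (M : {set {set V}}) : Prop :=
  M \subset E /\ forall v, (#|incident M v| <= q v)%N.

Definition maximal_q_matching (V : finType) (E : {set {set V}}) (q : V -> nat)
    (M : {set {set V}}) : Prop :=
  q_matching E q M /\ forall e, e \in E :\: M -> ~ q_matching E q (e |: M).

Definition saturated (V : finType) (q : V -> nat) (M : {set {set V}}) (v : V) :
  bool := #|incident M v| == q v.

(* [A] is one side of a bipartition of the graph. *)
Definition bipartition (V : finType) (E : {set {set V}}) (A : {set V}) : Prop :=
  forall e, e \in E -> #|e :&: A| = 1%N.

(** * Preferences

   The value p_v(u) = p_v(uv) is [p v [set u; v]]; only the values [p v e]
   with [e] an edge incident to [v] are meaningful. *)

Definition prefs (R : realType) (V : finType) := V -> {set V} -> R.

(* [e] is meant to be an edge outside [M]: each of its endpoints is unsaturated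
   or strictly prefers [e] to one of its edges in [M]. *)
Definition blocks (R : realType) (V : finType) (q : V -> nat)
    (M : {set {set V}}) (p : prefs R V) (e : {set V}) : bool :=
  [forall v in e, ~~ saturated q M v ||
                  [exists f in incident M v, p v f < p v e]].

Definition weakly_stable (R : realType) (V : finType) (E : {set {set V}})
    (q : V -> nat) (M : {set {set V}}) (p : prefs R V) : Prop :=
  forall e, e \in E :\: M -> ~~ blocks q M p e.

Definition dominated (R : realType) (V : finType) (q : V -> nat)
    (M : {set {set V}}) (p : prefs R V) (v : V) (e : {set V}) : bool :=
  saturated q M v && [forall f in incident M v, p v e <= p v f].

Record bounds (R : realType) (V : finType) := Bounds {
  lower : V -> {set V} -> R;
  upper : V -> {set V} -> R }.

(* [None] is the problem without bounds, [Some b] the one with bounds. *)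
Definition bounds_ok (R : realType) (V : finType) (E : {set {set V}})
    (b : option (bounds R V)) : Prop :=
  if b is Some b then
    forall v e, e \in incident E v -> 0 <= lower b v e <= upper b v e
  else True.

Definition admissible_at (R : realType) (V : finType) (E : {set {set V}})
    (b : option (bounds R V)) (v : V) (y : {set V} -> R) : Prop :=
  forall e, e \in incident E v ->
    0 <= y e /\ (if b is Some b then lower b v e <= y e <= upper b v e
                 else True).

Definition admissible (R : realType) (V : finType) (E : {set {set V}})
    (b : option (bounds R V)) (p : prefs R V) : Prop :=
  forall v, admissible_at E b v (p v).

Definition weighted_cost (R : realType) (V : finType) (E : {set {set V}})
    (lam : V -> R) (p p' : prefs R V) : R :=
  \sum_(v : V) \sum_(u in nbr E v)
     lam v * `|p v [set u; v] - p' v [set u; v]|.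

Definition feasible_prefs (R : realType) (V : finType) (E : {set {set V}})
    (q : V -> nat) (M : {set {set V}}) (b : option (bounds R V))
    (p' : prefs R V) : Prop :=
  admissible E b p' /\ weakly_stable E q M p'.

(* Equal to +oo when no admissible preferences make [M] weakly stable. *)
Definition min_modification_cost (R : realType) (V : finType)
    (E : {set {set V}}) (q : V -> nat) (M : {set {set V}})
    (b : option (bounds R V)) (lam : V -> R) (p : prefs R V) : \bar R :=
  ereal_inf [set ((weighted_cost E lam p p')%:E)%E
            | p' in [set p' | feasible_prefs E q M b p']]%classic.

(** * Preprocessing *)

Definition clamp (R : realType) (V : finType) (b : option (bounds R V))
    (p : prefs R V) : prefs R V :=
  fun v e =>
    if b is Some b then
      if p v e < lower b v e then lower b v e
      else if upper b v e < p v e then upper b v e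
      else p v e
    else p v e.

Definition reduced_edges (R : realType) (V : finType) (E : {set {set V}})
    (q : V -> nat) (M : {set {set V}}) (p : prefs R V) : {set {set V}} :=
  [set e in E | (e \in M) || blocks q M p e].

(** * The auxiliary graph H

   From here on [E] is the edge set that remains after the preprocessing.  The
   copy v_j of v created for the edge e^v_j is the pair (v, e^v_j). *)

Definition copies (V : finType) (E M : {set {set V}}) : {set V * {set V}} :=
  [set x | x.2 \in incident (E :\: M) x.1].

Definition Hadj (V : finType) (E M : {set {set V}}) : rel (V * {set V}) :=
  fun x y => [&& [set x.1; y.1] \in E :\: M,
                 x.2 == [set x.1; y.1] & y.2 == [set x.1; y.1]].

Definition vertex_cover (V : finType) (E M : {set {set V}})
    (X : {set V * {set V}}) : Prop :=
  X \subset copies E M /\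
  forall x y, Hadj E M x y -> (x \in X) || (y \in X).

(* The copies of the vertices in [A]. *)
Definition copies_on (V : finType) (E M : {set {set V}}) (A : {set V}) :
  {set V * {set V}} := [set x in copies E M | x.1 \in A].

(* The edges e^v_j such that v_j belongs to [X]. *)
Definition edges_at (V : finType) (v : V) (X : {set V * {set V}}) :
  {set {set V}} := [set e | (v, e) \in X].

(** * The programs LP_v, with objective multiplied by [lam v] *)

(* [J] is the set of edges e^v_{j_i} of the selected copies of [v]. *)
Definition LP_feasible (R : realType) (V : finType) (E M : {set {set V}})
    (b : option (bounds R V)) (v : V) (J : {set {set V}})
    (x : {set V} -> R) : Prop :=
  [/\ forall e, e \in J -> 0 <= x e,
      forall e f, e \in J -> f \in incident M v -> x e <= x f &
      if b is Some b then
        (forall e, e \in incident M v -> 0 <= x e <= upper b v e) /\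
        (forall e, e \in incident (E :\: M) v -> lower b v e <= x e)
      else True].

Definition LP_objective (R : realType) (V : finType) (E : {set {set V}})
    (lam : V -> R) (p : prefs R V) (v : V) (x : {set V} -> R) : R :=
  lam v * \sum_(e in incident E v) `|x e - p v e|.

(* Equal to +oo when the program is infeasible. *)
Definition LP_value (R : realType) (V : finType) (E M : {set {set V}})
    (b : option (bounds R V)) (lam : V -> R) (p : prefs R V) (v : V)
    (J : {set {set V}}) : \bar R :=
  ereal_inf [set ((LP_objective E lam p v x)%:E)%E
            | x in [set x | LP_feasible E M b v J x]]%classic.

Definition min_domination_cost (R : realType) (V : finType)
    (E M : {set {set V}}) (b : option (bounds R V)) (lam : V -> R)
    (p : prefs R V) (q : V -> nat) (v : V) (J : {set {set V}}) : \bar R :=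
  ereal_inf [set ((LP_objective E lam p v (p' v))%:E)%E
            | p' in [set p' | admissible E b p' /\
                     forall e, e \in J -> dominated q M p' v e]]%classic.

(** * The cost function on sets of copies *)

Definition vertex_cost (R : realType) (V : finType) (E : {set {set V}})
    (q : V -> nat) (M : {set {set V}}) (b : option (bounds R V)) (lam : V -> R)
    (p : prefs R V) (v : V) (X : {set V * {set V}}) : \bar R :=
  if edges_at v X == finset.set0 then 0%E
  else if saturated q M v then LP_value E M b lam p v (edges_at v X)
  else +oo%E.

(* The sum of f_v(X) over the vertices v in [A]; the function c is the case
   where [A] is the full vertex set. *)
Definition cost_on (R : realType) (V : finType) (E : {set {set V}})
    (q : V -> nat) (M : {set {set V}}) (b : option (bounds R V)) (lam : V -> R)
    (p : prefs R V) (A : {set V}) (X : {set V * {set V}}) : \bar R :=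
  (\sum_(v in A) vertex_cost E q M b lam p v X)%E.

Definition cover_cost (R : realType) (V : finType) (E : {set {set V}})
    (q : V -> nat) (M : {set {set V}}) (b : option (bounds R V)) (lam : V -> R)
    (p : prefs R V) (X : {set V * {set V}}) : \bar R :=
  cost_on E q M b lam p [set: V] X.

Definition min_cover_cost (R : realType) (V : finType) (E : {set {set V}})
    (q : V -> nat) (M : {set {set V}}) (b : option (bounds R V)) (lam : V -> R)
    (p : prefs R V) : \bar R :=
  ereal_inf [set cover_cost E q M b lam p X
            | X in [set X | vertex_cover E M X]]%classic.

Definition submodular_on (R : realType) (T : finType) (S : {set T})
    (f : {set T} -> \bar R) : Prop :=
  forall X Y : {set T}, X \subset S -> Y \subset S ->
    (f (X :&: Y) + f (X :|: Y) <= f X + f Y)%E.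

(* Main.v *)
(** The weight [lam v] only rescales the program of the agent [v], and clamping
is an l1-projection onto a box, so the cost of any admissible [p'] is the cost
of clamping plus the sum over [v] of the objective of LP_v at [p' v].  Each
LP_v attains its optimum at preferences that cut the selected edges down to a
common threshold and raise the matching edges up to it; these preferences are
admissible, and the deleted edges still do not block.  Hence a cover of finite
cost c(X) and preferences of cost c(X) plus the clamping cost are obtained from
each other. *)

Require Import Defs.
From mathcomp Require Import all_boot all_order all_algebra.
From mathcomp Require Import all_classical all_reals ereal.
From mathcomp Require Import topology normedtype derive.
From mathcomp Require Import lra.

Set Implicit Arguments.
Unset Strict Implicit.
Unset Printing Implicit Defensive.

Import Order.TTheory GRing.Theory Num.Theory.
Import numFieldNormedType.Exports.
Local Open Scope ring_scope.

(** * Threshold modifications at a single agent *)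

(** With [J] the edges to dominate and [N] the disjoint set of matching edges, this is the
    l1-closest vector to [p] that is at most [t] on [J] and at least [t] on [N]. *)
Definition threshold (R : realType) (T : finType) (J N : {set T}) (p : T -> R)
    (t : R) : T -> R :=
  fun e => if e \in J then Num.min (p e) t
           else if e \in N then Num.max (p e) t else p e.

Lemma threshold_dominates (R : realType) (T : finType) (J N : {set T})
    (p : T -> R) (t : R) (e f : T) :
  [disjoint J & N] -> e \in J -> f \in N ->
  threshold J N p t e <= threshold J N p t f.
Proof.
move=> dJN eJ fN; rewrite /threshold eJ (disjointFl dJN fN) fN.
by rewrite (@le_trans _ _ t) // ?ge_min ?le_max lexx orbT.
Qed.

Lemma threshold_raises (R : realType) (T : finType) (J N : {set T})
    (p : T -> R) (t : R) (f : T) :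
  f \notin J -> p f <= threshold J N p t f.
Proof.
by rewrite /threshold => /negPf ->; case: ifP => // _; rewrite le_max lexx.
Qed.

(** Needed for the extreme value theorem, which supplies the best threshold. *)
Lemma threshold_cost_continuous (R : realType) (T : finType)
    (S J N : {set T}) (p : T -> R) :
  continuous (fun t => \sum_(e in S) `|threshold J N p t e - p e|).
Proof.
move=> t; apply: cvg_big => [|e _]; first exact: add_continuous.
apply: cvg_norm; apply: cvgB; last exact: cvg_cst.
rewrite /threshold; case: ifP => _; last case: ifP => _; last exact: cvg_cst.
- by apply: (@continuous_min _ _ (fun=> p e) id);
  [exact: cvg_cst|exact: cvg_id].
- by apply: (@continuous_max _ _ (fun=> p e) id);
  [exact: cvg_cst|exact: cvg_id].
Qed.

Lemma incidentS (V : finType) (F E : {set {set V}}) (v : V) :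
  F \subset E -> incident F v \subset incident E v.
Proof.
move=> FE; apply/fintype.subsetP => e; rewrite !inE.
by move=> /andP[/(fintype.subsetP FE) -> ->].
Qed.

Lemma incidentD_disjoint (V : finType) (F M J : {set {set V}}) (v : V) :
  J \subset incident (F :\: M) v -> [disjoint J & incident M v].
Proof.
move=> JF; rewrite disjoint_subset.
apply/fintype.subsetP => e /(fintype.subsetP JF).
by rewrite !inE => /andP[/andP[/negPf -> _] _].
Qed.

(* Only the threshold that separates the dominated edges from the matching
   edges matters, so the program is a one-dimensional minimization over a
   compact interval. *)
Lemma LP_optimum (R : realType) (V : finType) (E F M : {set {set V}})
    (b : option (bounds R V)) (v : V) (p x0 : {set V} -> R)
    (J : {set {set V}}) :
  F \subset E -> M \subset F -> J \subset incident (F :\: M) v ->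
  admissible_at E b v p -> LP_feasible F M b v J x0 ->
  exists t,
    admissible_at E b v (threshold J (incident M v) p t) /\
    forall x, LP_feasible F M b v J x ->
      \sum_(e in incident F v) `|threshold J (incident M v) p t e - p e| <=
      \sum_(e in incident F v) `|x e - p e|.
Proof.
move=> FE MF JF pb Fx0; set N := incident M v.
have NE : N \subset incident E v.
  by apply: incidentS; apply: fintype.subset_trans FE.
have JE : J \subset incident E v.
  apply: fintype.subset_trans JF _; apply: incidentS.
  by rewrite subDset subsetU // FE orbT.
have dJN : [disjoint J & N] := incidentD_disjoint JF.
(* Beyond [T] no edge of [J] is lowered, so larger thresholds cannot help. [L] respects the lower
   bounds on [J], [U] the upper bounds on [N]; without bounds the interval from [L] to [U] is [0,
   [T]]. *)
pose T := \big[Num.max/0]_(e in J) p e.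
pose lo e := if b is Some b then lower b v e else 0.
pose hi e := if b is Some b then upper b v e else T.
pose L := \big[Num.max/0]_(e in J) lo e.
pose U := \big[Num.min/T]_(f in N) hi f.
have T0 : 0 <= T by apply: bigmax_ge_id.
have L0 : 0 <= L by apply: bigmax_ge_id.
have pT e : e \in J -> p e <= T by move=> eJ; apply: le_bigmax_cond.
have loL e : e \in J -> lo e <= L by move=> eJ; apply: le_bigmax_cond.
have Uhi f : f \in N -> U <= hi f by move=> fN; apply: bigmin_le_cond.
have adm t : L <= t <= U -> admissible_at E b v (threshold J N p t).
  move=> /andP[Lt tU] e eE; have [p0 pbe] := pb e eE.
  have t0 := le_trans L0 Lt.
  rewrite /threshold; case: ifPn => [eJ|_]; last case: ifPn => [eN|_].
  - have := le_trans (loL e eJ) Lt; rewrite /lo le_min p0 t0.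
    case: (b) pbe => // b' /andP[l u] l'.
    by rewrite le_min l l' ge_min u.
  - have := le_trans tU (Uhi e eN); rewrite /hi le_max p0.
    case: (b) pbe => // b' /andP[l u] u'.
    by rewrite le_max l ge_max u u'.
  - by [].
(* Any feasible [x] is matched by the threshold [m], its largest value on [J], capped at [T]: on
   each edge [x] moves at least as far from [p] as the threshold vector does. *)
have red x : LP_feasible F M b v J x -> exists2 t, L <= t <= U &
    \sum_(e in incident F v) `|threshold J N p t e - p e| <=
    \sum_(e in incident F v) `|x e - p e|.
  move=> [x0' xdom xb]; pose m := \big[Num.max/0]_(e in J) x e.
  have m0 : 0 <= m by apply: bigmax_ge_id.
  have xm e : e \in J -> x e <= m by move=> eJ; apply: le_bigmax_cond.
  (* The alternative [p f] covers empty [J], where [m] takes the default value 0 and [x f] may be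
     negative. *)
  have mN f : f \in N -> m <= Num.max (x f) (p f).
    move=> fN; apply: bigmax_le => [|e eJ].
      have [p0 _] := pb f (fintype.subsetP NE f fN).
      by rewrite le_max p0 orbT.
    by rewrite le_max xdom.
  exists (Num.min T m).
    apply/andP; split.
      apply: bigmax_le => [|e eJ]; rewrite le_min ?T0 //.
      have [p0 pbe] := pb e (fintype.subsetP JE e eJ).
      rewrite (le_trans _ (pT e eJ)) /= ?(le_trans _ (xm e eJ)) //.
        rewrite /lo; case: (b) xb => [b' [_ ->] //|_]; last exact: x0'.
        exact: (fintype.subsetP JF).
      by rewrite /lo; case: (b) pbe => // b' /andP[].
    apply: le_bigmin => [|f fN]; first by rewrite ge_min lexx.
    have [p0 pbf] := pb f (fintype.subsetP NE f fN).
    rewrite ge_min /hi; case: (b) pbf xb => [b' /andP[_ u] [xN _]|]; last first.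
      by rewrite lexx.
    rewrite (le_trans (mN f fN)) ?orbT // ge_max u andbT.
    by have /andP[] := xN f fN.
  apply: ler_sum => e eF; rewrite /threshold.
  case: ifPn => [eJ|_]; last case: ifPn => [eN|_].
  - have := pT e eJ; have := xm e eJ.
    move=> xem peT; have [pm|mp] := leP (p e) m.
      by rewrite min_l ?subrr ?normr0 ?normr_ge0 // le_min peT pm.
    rewrite (min_r (ltW (lt_le_trans mp peT))) (min_r (ltW mp)).
    by rewrite !ler0_norm; lra.
  - have := mN e eN.
    rewrite le_max => xp; have [tp|pt] := leP (Num.min T m) (p e).
      by rewrite subrr normr0 normr_ge0.
    have tm : Num.min T m <= m by rewrite ge_min lexx orbT.
    by case/orP: xp => xp; rewrite ?ger0_norm; lra.
  - by rewrite subrr normr0.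
(* Feasibility of the program enters here: it makes the interval nonempty. *)
have [t0 /andP[Lt0 t0U] _] := red x0 Fx0.
have LU := le_trans Lt0 t0U.
have [t tLU tmin] := EVT_min LU
  (continuous_subspaceT (@threshold_cost_continuous R _ (incident F v) J N p)).
exists t; split; first by apply: adm; move: tLU; rewrite in_itv.
move=> x /red[t' t'LU]; apply: le_trans.
by apply: tmin; rewrite in_itv.
Qed.

(** * Optimal values of the programs and their submodularity *)

Lemma LP_objective_ge0 (R : realType) (V : finType) (F : {set {set V}})
    (lam : V -> R) (p : prefs R V) (v : V) (x : {set V} -> R) :
  0 <= lam v -> 0 <= LP_objective F lam p v x.
Proof. by move=> lam0; rewrite mulr_ge0 // sumr_ge0. Qed.

Lemma LP_objectiveS (R : realType) (V : finType) (F E : {set {set V}})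
    (lam : V -> R) (p : prefs R V) (v : V) (x : {set V} -> R) :
  0 <= lam v -> F \subset E ->
  LP_objective F lam p v x <= LP_objective E lam p v x.
Proof.
move=> lam0 FE; rewrite ler_wpM2l //.
rewrite [leRHS](big_setID (incident F v)) /= (finset.setIidPr (incidentS v FE)).
by rewrite lerDl sumr_ge0.
Qed.

Lemma LP_objective_off (R : realType) (V : finType) (F E : {set {set V}})
    (lam : V -> R) (p : prefs R V) (v : V) (x : {set V} -> R) :
  F \subset E -> (forall e, e \notin F -> x e = p v e) ->
  LP_objective E lam p v x = LP_objective F lam p v x.
Proof.
move=> FE xp; congr (_ * _).
rewrite (big_setID (incident F v)) /= (finset.setIidPr (incidentS v FE)).
rewrite [X in _ + X]big1 ?addr0 // => e; rewrite !inE => /andP[eF /andP[_ ve]].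
by rewrite xp ?subrr ?normr0 //; move: eF; rewrite ve andbT.
Qed.

(** The program is a relaxation: with bounds, it keeps the upper ones on matching edges and the
    lower ones on the other edges. *)
Lemma admissible_LP_feasible (R : realType) (V : finType)
    (E F M : {set {set V}}) (b : option (bounds R V)) (v : V)
    (y : {set V} -> R) (J : {set {set V}}) :
  F \subset E -> M \subset F -> J \subset incident (F :\: M) v ->
  admissible_at E b v y ->
  (forall e f, e \in J -> f \in incident M v -> y e <= y f) ->
  LP_feasible F M b v J y.
Proof.
move=> FE MF JF yb ydom.
have FME : incident (F :\: M) v \subset incident E v.
  by apply: incidentS; rewrite subDset subsetU // FE orbT.
have NE : incident M v \subset incident E v.
  by apply: incidentS; apply: fintype.subset_trans FE.
split => // [e eJ|].
  by case: (yb e (fintype.subsetP (fintype.subset_trans JF FME) _ eJ)).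
case: b yb => // b yb; split => e ev.
  by case: (yb e (fintype.subsetP NE _ ev)) => -> /andP[].
by case: (yb e (fintype.subsetP FME _ ev)) => _ /andP[].
Qed.

Lemma LP_value_ge0 (R : realType) (V : finType) (F M : {set {set V}})
    (b : option (bounds R V)) (lam : V -> R) (p : prefs R V) (v : V)
    (J : {set {set V}}) :
  0 <= lam v -> (0 <= LP_value F M b lam p v J)%E.
Proof.
move=> lam0; apply/ereal_infP => _ [x _ <-].
by rewrite lee_fin LP_objective_ge0.
Qed.

Lemma LP_value_le (R : realType) (V : finType) (F M : {set {set V}})
    (b : option (bounds R V)) (lam : V -> R) (p : prefs R V) (v : V)
    (J : {set {set V}}) (x : {set V} -> R) :
  LP_feasible F M b v J x ->
  (LP_value F M b lam p v J <= (LP_objective F lam p v x)%:E)%E.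
Proof. by move=> Fx; apply: ereal_inf_lbound; exists x. Qed.

(** Some minimizer of the relaxed program is a threshold vector, hence satisfies every admissibility
    constraint of the larger edge set [E]. Value [+oo] is the infeasible case. *)
Lemma LP_value_attained (R : realType) (V : finType) (E F M : {set {set V}})
    (b : option (bounds R V)) (lam : V -> R) (p : prefs R V) (v : V)
    (J : {set {set V}}) :
  F \subset E -> M \subset F -> J \subset incident (F :\: M) v ->
  admissible_at E b v (p v) -> 0 <= lam v ->
  LP_value F M b lam p v J = +oo%E \/
  exists t y, [/\ y = threshold J (incident M v) (p v) t,
        admissible_at E b v y, LP_feasible F M b v J y &
        LP_value F M b lam p v J = (LP_objective F lam p v y)%:E].
Proof.
move=> FE MF JF pb lam0.
have [[x0 Fx0]|noF] := pselect (exists x, LP_feasible F M b v J x).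
  right; have [t [tb tmin]] := LP_optimum FE MF JF pb Fx0.
  exists t; set y := threshold _ _ _ _ in tb tmin *; exists y.
  have Fy : LP_feasible F M b v J y.
    apply: (admissible_LP_feasible FE) => // e f.
    exact/threshold_dominates/(incidentD_disjoint JF).
  split => //; apply/eqP; rewrite eq_le LP_value_le //=.
  apply/ereal_infP => _ [x Fx <-].
  by rewrite lee_fin ler_wpM2l // tmin.
left; apply/eqP; rewrite -leye_eq; apply/ereal_infP => y [x Fx _].
by case: noF; exists x.
Qed.

Lemma LP_value_domination (R : realType) (V : finType) (F M : {set {set V}})
    (b : option (bounds R V)) (lam : V -> R) (p : prefs R V) (q : V -> nat)
    (v : V) (J : {set {set V}}) :
  M \subset F -> J \subset incident (F :\: M) v -> admissible F b p ->
  0 <= lam v -> saturated q M v ->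
  LP_value F M b lam p v J = min_domination_cost F M b lam p q v J.
Proof.
move=> MF JF pb lam0 sat; apply/eqP; rewrite eq_le; apply/andP; split.
  apply/ereal_infP => _ [p' [p'b p'dom] <-]; apply: LP_value_le.
  apply: (admissible_LP_feasible (fintype.subxx F)) => // e f /p'dom/andP[_].
  by move/fintype.forall_inP; apply.
have [->|[t [y [_ yb [_ ydom _] ->]]]] :=
    LP_value_attained (fintype.subxx F) MF JF (pb v) lam0; first exact: leey.
(* Domination at [v] concerns only the values of [v], so the other agents keep theirs. *)
pose p' u := if u == v then y else p u.
have p'v : p' v = y by rewrite /p' eqxx.
apply: ereal_inf_lbound; exists p'; last by rewrite p'v.
split=> [u|e eJ]; first by rewrite /p'; case: eqVneq => [->|].
rewrite /dominated sat p'v; apply/fintype.forall_inP => f fM; exact: ydom.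
Qed.

(* Of two feasible points, one has its dominated edges below the matching
   edges of the other; exchanging the coordinates in [J \ K] then gives
   feasible points for the union and the intersection. *)
Lemma LP_feasible_exchange (R : realType) (V : finType) (F M : {set {set V}})
    (b : option (bounds R V)) (v : V) (J K : {set {set V}})
    (x y : {set V} -> R) :
  J \subset incident (F :\: M) v ->
  LP_feasible F M b v J x -> LP_feasible F M b v K y ->
  (forall e f, e \in J -> f \in incident M v -> x e <= y f) ->
  LP_feasible F M b v (J :|: K) (fun e => if e \in J :\: K then x e else y e) /\
  LP_feasible F M b v (J :&: K) (fun e => if e \in J :\: K then y e else x e).
Proof.
move=> JF [x0 xdom xb] [y0 ydom yb] xy.
have dJN := incidentD_disjoint JF.
split; split=> [e|e f|];
  rewrite ?(finset.in_setU, finset.in_setI, finset.in_setD).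
- by case: (boolP (e \in K)) (x0 e) (y0 e)  => eK;
  case: (e \in J) => //= xe ye _; auto.
- move=> eJK fN; rewrite (disjointFl dJN fN) andbF; move: eJK.
  case: (boolP (e \in K)) (xy e f) (ydom e f)  => eK;
  case: (e \in J) => //= xe ye _; auto.
- by case: (b) xb yb => // b' [xM xF] [yM yF]; split=> e ev; case: ifP; auto.
- by case/andP=> eJ ->; rewrite eJ /=; apply: x0.
- by case/andP=> eJ -> fN; rewrite eJ (disjointFl dJN fN) andbF /=; apply: xdom.
- by case: (b) xb yb => // b' [xM xF] [yM yF]; split=> e ev; case: ifP; auto.
Qed.

(** Optimal points for [J] and [K] are exchanged into feasible points for the union and the
    intersection with the same total objective. *)
Lemma LP_value_submodular (R : realType) (V : finType) (F M : {set {set V}})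
    (b : option (bounds R V)) (lam : V -> R) (p : prefs R V) (v : V)
    (J K : {set {set V}}) :
  M \subset F -> J \subset incident (F :\: M) v ->
  K \subset incident (F :\: M) v -> admissible_at F b v (p v) -> 0 <= lam v ->
  (LP_value F M b lam p v (J :&: K) + LP_value F M b lam p v (J :|: K) <=
   LP_value F M b lam p v J + LP_value F M b lam p v K)%E.
Proof.
move=> MF JF KF pb lam0.
have noNy A : LP_value F M b lam p v A != -oo%E.
  by rewrite gt_eqF // (lt_le_trans _ (LP_value_ge0 _ _ _ _ _ lam0)) ?ltNyr.
have [->|[s [x [_ _ Fx ->]]]] :=
    LP_value_attained (fintype.subxx F) MF JF pb lam0.
  by rewrite addye ?leey.
have [->|[t [y [_ _ Fy ->]]]] :=
    LP_value_attained (fintype.subxx F) MF KF pb lam0.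
  by rewrite addey ?leey.
wlog xy : J K JF KF x y Fx Fy / forall e f, e \in J -> f \in incident M v ->
    x e <= y f => [main|].
  have [xy|] := pselect
      (forall e f, e \in J -> f \in incident M v -> x e <= y f).
    exact: main.
  (* If [y f0 < x e0], then [y e <= y f0 < x e0 <= x f] for all [e] in [K] and matching edges [f],
     so [J] and [K] swap roles. *)
  move/existsNP => [e0 /existsNP[f0 /not_implyP[e0J /not_implyP[f0N /negP]]]].
  rewrite -ltNge => yx; rewrite finset.setIC finset.setUC [leRHS]addeC.
  apply: main => // e f eK fN; have [_ xdom _] := Fx; have [_ ydom _] := Fy.
  by rewrite (le_trans (ydom e f0 eK f0N)) // (le_trans (ltW yx)) // xdom.
have [FU FI] := LP_feasible_exchange JF Fx Fy xy.
rewrite (le_trans (leeD (LP_value_le lam p FI) (LP_value_le lam p FU))) //.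
rewrite -!EFinD lee_fin -!mulrDr ler_wpM2l // -!big_split /=.
(* At each edge the exchange merely permutes the two summands. *)
by apply: ler_sum => e _; case: ifP => _; rewrite // addrC.
Qed.

(** * Clamping as an l1-projection, and the weighted cost by edges *)

Lemma clamp_admissible (R : realType) (V : finType) (E : {set {set V}})
    (b : option (bounds R V)) (p : prefs R V) :
  bounds_ok E b -> (forall v e, e \in incident E v -> 0 <= p v e) ->
  admissible E b (clamp b p).
Proof.
move=> bE p0 v e ev; have := p0 v e ev; rewrite /clamp.
case: b bE => // b bE; have /andP[l0 lu] := bE v e ev.
move=> pve0; case: (ltP (p v e) (lower b v e)) => [_|lp].
  by rewrite l0 lexx lu.
case: (ltP (upper b v e) (p v e)) => [_|pu]; last by rewrite pve0 lp pu.
by rewrite (le_trans l0 lu) lexx lu.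
Qed.

(** The clamped value lies between [p v e] and any value within the bounds, so the distances add
    up. *)
Lemma clamp_dist (R : realType) (V : finType) (E : {set {set V}})
    (b : option (bounds R V)) (p : prefs R V) (v : V) (y : {set V} -> R)
    (e : {set V}) :
  admissible_at E b v y -> e \in incident E v ->
  `|p v e - y e| = `|p v e - clamp b p v e| + `|y e - clamp b p v e|.
Proof.
move=> yb /yb[_]; rewrite /clamp; case: b {yb} => [b|_].
  move=> /andP[ly yu]; case: (ltP (p v e)) => lp.
    by rewrite ![`|p v e - _|]distrC !ger0_norm; lra.
  case: ltP => up; last by rewrite subrr normr0 add0r distrC.
  by rewrite [`|y e - _|]distrC !ger0_norm; lra.
by rewrite subrr normr0 add0r distrC.
Qed.

(** Without loops, sending [u] to the edge [[set u; v]] is a bijection from the neighbours of [v] to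
    its incident edges. *)
Lemma weighted_costE (R : realType) (V : finType) (E : {set {set V}})
    (lam : V -> R) (p p' : prefs R V) :
  simple_graph E ->
  weighted_cost E lam p p' =
    \sum_(v : V) lam v * \sum_(e in incident E v) `|p v e - p' v e|.
Proof.
move=> HE; apply: eq_bigr => v _; rewrite -mulr_sumr; congr (_ * _).
have neq u : u \in nbr E v -> u != v.
  rewrite inE => /HE; case: eqVneq => // ->.
  by rewrite finset.setUid cards1.
have inj : {in nbr E v &, injective (fun u => [set u; v])}.
  move=> u w /neq uv _ /setP/(_ u); rewrite !inE eqxx /= (negPf uv) orbF.
  by move=> /esym/eqP.
rewrite -(big_imset (fun e => `|p v e - p' v e|) inj) /=.
apply: eq_bigl => e; rewrite inE; apply/imsetP/andP => [[u]|[eE ve]].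
  by rewrite inE => uE ->; rewrite uE !inE eqxx orbT.
have /eqP/cards2P[u [w [uw ee]]] := HE e eE.
move: ve; rewrite ee !inE => /orP[]/eqP ->.
  by exists w; rewrite ?inE finset.setUC // -ee.
by exists u; rewrite ?inE // -ee.
Qed.

Lemma weighted_cost_clamp (R : realType) (V : finType) (E : {set {set V}})
    (b : option (bounds R V)) (lam : V -> R) (p p' : prefs R V) :
  simple_graph E -> admissible E b p' ->
  weighted_cost E lam p p' = weighted_cost E lam p (clamp b p) +
    \sum_(v : V) LP_objective E lam (clamp b p) v (p' v).
Proof.
move=> HE p'b; rewrite !weighted_costE // -big_split; apply: eq_bigr => v _ /=.
rewrite -mulrDr -big_split; congr (_ * _); apply: eq_bigr => e ev /=.
exact: clamp_dist ev.
Qed.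

(** * The cost function on sets of copies *)

Lemma edges_atS (V : finType) (F M : {set {set V}}) (v : V)
    (X : {set V * {set V}}) :
  X \subset copies F M -> edges_at v X \subset incident (F :\: M) v.
Proof.
move=> XF; apply/fintype.subsetP => e.
by rewrite inE => /(fintype.subsetP XF); rewrite inE.
Qed.

Lemma edges_at_copies_on (V : finType) (F M : {set {set V}}) (A : {set V})
    (v : V) (X : {set V * {set V}}) :
  X \subset copies F M -> v \in A ->
  edges_at v (X :&: copies_on F M A) = edges_at v X.
Proof.
move=> XF vA; apply/setP => e; rewrite !inE vA andbT.
by apply: andb_idr => /(fintype.subsetP XF); rewrite !inE.
Qed.

Lemma edges_atI (V : finType) (v : V) (X Y : {set V * {set V}}) :
  edges_at v (X :&: Y) = edges_at v X :&: edges_at v Y.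
Proof. by apply/setP => e; rewrite !inE. Qed.

Lemma edges_atU (V : finType) (v : V) (X Y : {set V * {set V}}) :
  edges_at v (X :|: Y) = edges_at v X :|: edges_at v Y.
Proof. by apply/setP => e; rewrite !inE. Qed.

Lemma vertex_cost_ge0 (R : realType) (V : finType) (F : {set {set V}})
    (q : V -> nat) (M : {set {set V}}) (b : option (bounds R V)) (lam : V -> R)
    (p : prefs R V) (v : V) (X : {set V * {set V}}) :
  0 <= lam v -> (0 <= vertex_cost F q M b lam p v X)%E.
Proof.
move=> lam0; rewrite /vertex_cost; case: ifP => // _.
case: ifP => _; rewrite ?leey //.
exact: LP_value_ge0.
Qed.

Lemma cost_on_ge0 (R : realType) (V : finType) (F : {set {set V}})
    (q : V -> nat) (M : {set {set V}}) (b : option (bounds R V)) (lam : V -> R)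
    (p : prefs R V) (A : {set V}) (X : {set V * {set V}}) :
  (forall v, 0 <= lam v) -> (0 <= cost_on F q M b lam p A X)%E.
Proof. by move=> lam0; apply: sume_ge0 => v _; apply: vertex_cost_ge0. Qed.

(** The convention f_v = 0 in the absence of copies of [v] agrees with the program: for an empty
    selection [p v] itself is feasible at cost 0. *)
Lemma vertex_cost_saturated (R : realType) (V : finType) (F : {set {set V}})
    (q : V -> nat) (M : {set {set V}}) (b : option (bounds R V)) (lam : V -> R)
    (p : prefs R V) (v : V) (X : {set V * {set V}}) :
  M \subset F -> admissible_at F b v (p v) -> 0 <= lam v -> saturated q M v ->
  vertex_cost F q M b lam p v X = LP_value F M b lam p v (edges_at v X).
Proof.
move=> MF pb lam0 sat; rewrite /vertex_cost sat; case: eqP => // ->.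
apply/eqP; rewrite eq_le LP_value_ge0 //=.
have Fp : LP_feasible F M b v finset.set0 (p v).
  apply: (admissible_LP_feasible (fintype.subxx F)) => // [|e f].
    exact: finset.sub0set.
  by rewrite finset.in_set0.
rewrite (le_trans (LP_value_le lam p Fp)) // /LP_objective.
by rewrite big1 ?mulr0 // => e _; rewrite subrr normr0.
Qed.

Lemma vertex_cost_submodular (R : realType) (V : finType) (F : {set {set V}})
    (q : V -> nat) (M : {set {set V}}) (b : option (bounds R V)) (lam : V -> R)
    (p : prefs R V) (v : V) :
  M \subset F -> admissible_at F b v (p v) -> 0 <= lam v ->
  submodular_on (copies F M) (vertex_cost F q M b lam p v).
Proof.
move=> MF pb lam0 X Y XF YF.
have ge0 Z := vertex_cost_ge0 F q M b p Z lam0.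
have noNy Z : vertex_cost F q M b lam p v Z != -oo%E.
  by rewrite gt_eqF // (lt_le_trans _ (ge0 Z)) ?ltNyr.
have [sat|nsat] := boolP (saturated q M v).
  rewrite !vertex_cost_saturated // edges_atI edges_atU.
  by apply: LP_value_submodular; rewrite ?edges_atS.
(* At an unsaturated agent any selected copy costs [+oo], so only two empty selections give a finite
   right-hand side. *)
have [X0|X0] := eqVneq (edges_at v X) finset.set0; last first.
  rewrite [X in (_ <= X + _)%E]/vertex_cost (negPf X0) (negPf nsat).
  by rewrite addye ?leey.
have [Y0|Y0] := eqVneq (edges_at v Y) finset.set0; last first.
  rewrite [X in (_ <= _ + X)%E]/vertex_cost (negPf Y0) (negPf nsat).
  by rewrite addey ?leey.
rewrite /vertex_cost edges_atI edges_atU X0 Y0.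
by rewrite finset.setIid finset.setUid eqxx.
Qed.

Lemma cost_on_submodular (R : realType) (V : finType) (F : {set {set V}})
    (q : V -> nat) (M : {set {set V}}) (b : option (bounds R V)) (lam : V -> R)
    (p : prefs R V) (A : {set V}) (S : {set V * {set V}}) :
  S \subset copies F M -> M \subset F -> admissible F b p ->
  (forall v, 0 <= lam v) ->
  submodular_on S (cost_on F q M b lam p A).
Proof.
move=> SF MF pb lam0 X Y XS YS; rewrite /cost_on -!big_split /=.
by apply: lee_sum => v _; apply: vertex_cost_submodular => //;
  apply: fintype.subset_trans SF.
Qed.

(** Each f_v sees only the copies of [v], all of which lie on the side of [v]. *)
Lemma cover_cost_sides (R : realType) (V : finType) (F : {set {set V}})
    (q : V -> nat) (M : {set {set V}}) (b : option (bounds R V)) (lam : V -> R)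
    (p : prefs R V) (A : {set V}) (X : {set V * {set V}}) :
  X \subset copies F M ->
  cover_cost F q M b lam p X =
    (cost_on F q M b lam p A (X :&: copies_on F M A) +
     cost_on F q M b lam p (~: A) (X :&: copies_on F M (~: A)))%E.
Proof.
move=> XF; rewrite /cover_cost /cost_on (big_setID A) /=.
by congr (_ + _)%E; rewrite ?finset.setTI ?finset.setTD; apply: eq_bigr => v vA;
  rewrite /vertex_cost edges_at_copies_on.
Qed.

Lemma Hadj_bipartition (V : finType) (E F M : {set {set V}}) (A : {set V})
    (x y : V * {set V}) :
  simple_graph E -> F \subset E -> bipartition E A -> Hadj F M x y ->
  (x.1 \in A) != (y.1 \in A).
Proof.
move=> HE FE HA /and3P[]; rewrite inE => /andP[_ /(fintype.subsetP FE) eE] _ _.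
move: (HE _ eE) (HA _ eE); rewrite cards2 finset.setIUl.
case: eqVneq => // neq _.
have I1 (z : V) : [set z] :&: A = if z \in A then [set z] else finset.set0.
  by case: ifPn => zA; apply/setP => w; rewrite !inE; case: eqVneq => //= ->;
    rewrite ?zA // (negPf zA).
rewrite !I1; case: (x.1 \in A); case: (y.1 \in A) => //=.
  by rewrite cards2 neq.
by rewrite finset.setU0 cards0.
Qed.

(** * Translation between vertex covers and preferences *)

(** The last two conjuncts serve the deleted edges: their values stay fixed and no unselected edge
    is lowered, so they remain dominated where they were. *)
Lemma vertex_cost_attained (R : realType) (V : finType) (E F : {set {set V}})
    (q : V -> nat) (M : {set {set V}}) (b : option (bounds R V)) (lam : V -> R)
    (p : prefs R V) (v : V) (X : {set V * {set V}}) :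
  F \subset E -> M \subset F -> X \subset copies F M ->
  admissible_at E b v (p v) -> 0 <= lam v ->
  (vertex_cost F q M b lam p v X < +oo)%E ->
  exists y : {set V} -> R,
    [/\ admissible_at E b v y, LP_feasible F M b v (edges_at v X) y,
        vertex_cost F q M b lam p v X = (LP_objective F lam p v y)%:E,
        (forall e, e \in edges_at v X -> dominated q M (fun=> y) v e) &
        (forall e, e \notin edges_at v X -> p v e <= y e) /\
        (forall e, e \notin F -> y e = p v e)].
Proof.
move=> FE MF XF pb lam0; have JF := edges_atS v XF.
rewrite /vertex_cost; case: eqP => [J0|J0].
  move=> _; exists (p v); split => //.
  - by apply: (admissible_LP_feasible FE) => // e f; rewrite J0 finset.in_set0.
  - by rewrite /LP_objective big1 ?mulr0 // => e _; rewrite subrr normr0.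
  - by move=> e; rewrite J0 finset.in_set0.
case: ifP => // sat fin.
case: (LP_value_attained FE MF JF pb lam0) fin =>
  [-> //|[t [y [-> yb Fy ->]]]] _.
exists (threshold (edges_at v X) (incident M v) (p v) t); split => //.
  move=> e eJ; rewrite /dominated sat; apply/fintype.forall_inP => f fN.
  exact/threshold_dominates/fN/eJ/(incidentD_disjoint JF).
split=> e; first exact: threshold_raises.
move=> eF; rewrite /threshold ifF; last first.
  apply: contraNF eF => /(fintype.subsetP JF); rewrite !inE.
  by case/andP=> /andP[].
rewrite ifF //; apply: contraNF eF.
by rewrite inE => /andP[/(fintype.subsetP MF)].
Qed.

(** The dominating endpoint [v] determines the copy [(v, e)] that covers the edge [e] in H. *)
Lemma not_blocksP (R : realType) (V : finType) (q : V -> nat)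
    (M : {set {set V}}) (p : prefs R V) (e : {set V}) :
  reflect (exists2 v, v \in e & dominated q M p v e) (~~ blocks q M p e).
Proof.
have domE v : dominated q M p v e =
    ~~ (~~ saturated q M v || [exists f in incident M v, p v f < p v e]).
  rewrite negb_or negbK; congr (_ && _).
  rewrite fintype.negb_exists; apply: fintype.eq_forallb => f.
  by rewrite negb_and -leNgt implybE.
rewrite /blocks fintype.negb_forall; apply: (iffP fintype.existsP).
  by case=> v; rewrite negb_imply -domE => /andP[]; exists v.
by case=> v ve dom; exists v; rewrite negb_imply ve -domE.
Qed.

Lemma sub_reduced_edges (R : realType) (V : finType) (E : {set {set V}})
    (q : V -> nat) (M : {set {set V}}) (p : prefs R V) :
  M \subset E -> M \subset reduced_edges E q M p.
Proof.
by move=> ME; apply/fintype.subsetP => e eM;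
  rewrite inE eM (fintype.subsetP ME).
Qed.

Lemma reduced_edgesS (R : realType) (V : finType) (E : {set {set V}})
    (q : V -> nat) (M : {set {set V}}) (p : prefs R V) :
  reduced_edges E q M p \subset E.
Proof. by apply/fintype.subsetP => e; rewrite inE => /andP[]. Qed.

Lemma vertex_cost_le_cover (R : realType) (V : finType) (F : {set {set V}})
    (q : V -> nat) (M : {set {set V}}) (b : option (bounds R V)) (lam : V -> R)
    (p : prefs R V) (X : {set V * {set V}}) (v : V) :
  (forall v, 0 <= lam v) ->
  (vertex_cost F q M b lam p v X <= cover_cost F q M b lam p X)%E.
Proof.
move=> lam0; rewrite /cover_cost /cost_on (bigD1 v) ?finset.in_setT //=.
by rewrite leeDl // sume_ge0 // => u _; apply: vertex_cost_ge0.
Qed.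

(* The optimal solutions of the programs never lower the value of a matching
   edge below its clamped value, so no deleted edge starts to block. *)
Lemma cover_feasible_prefs (R : realType) (V : finType) (E : {set {set V}})
    (q : V -> nat) (M : {set {set V}}) (p : prefs R V)
    (b : option (bounds R V)) (lam : V -> R) (X : {set V * {set V}}) :
  let pb := clamp b p in
  let F := reduced_edges E q M pb in
  simple_graph E -> M \subset E -> admissible E b pb ->
  (forall v, 0 <= lam v) -> vertex_cover F M X ->
  (cover_cost F q M b lam pb X < +oo)%E ->
  exists p' : prefs R V,
    [/\ feasible_prefs E q M b p',
        forall v, LP_feasible F M b v (edges_at v X) (p' v) &
        (weighted_cost E lam p p')%:E =
          ((weighted_cost E lam p pb)%:E + cover_cost F q M b lam pb X)%E].
Proof.
move=> pb F HE ME pbb lam0 [XF cov] cfin.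
have FE : F \subset E := reduced_edgesS _ _ _ _.
have MF : M \subset F := sub_reduced_edges _ _ ME.
(* All summands of the finite cover cost are nonnegative, so each is finite, and optimal vectors can
   be chosen independently agent by agent. *)
have [p' Hp'] := choice (fun v => vertex_cost_attained FE MF XF (pbb v) (lam0 v)
  (le_lt_trans (vertex_cost_le_cover F q M b pb X v lam0) cfin)).
have p'b : admissible E b p' by move=> v; case: (Hp' v).
have costE : (weighted_cost E lam p p')%:E =
    ((weighted_cost E lam p pb)%:E + cover_cost F q M b lam pb X)%E.
  rewrite (weighted_cost_clamp _ _ HE p'b) EFinD /cover_cost /cost_on.
  congr (_ + _)%E; rewrite -sumEFin; apply: eq_big => [v|v _].
    by rewrite finset.in_setT.
  by have [_ _ -> _ [_ off]] := Hp' v; rewrite (LP_objective_off _ FE off).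
exists p'; split; [split=> // | by move=> v; case: (Hp' v) | exact: costE].
move=> e; rewrite inE => /andP[eM eE]; apply/not_blocksP.
(* A remaining edge has a copy in the cover and is dominated there; a deleted edge stays dominated
   at the endpoint where the clamped preferences already dominate it. *)
have [eF|eF] := boolP (e \in F).
  have /eqP/cards2P[u [w [_ ee]]] := HE e eE.
  have : Hadj F M (u, e) (w, e) by rewrite /Hadj /= -ee inE eM eF eqxx.
  have dom z : (z, e) \in X -> dominated q M p' z e.
    by move=> zX; have [_ _ _ dom _] := Hp' z; apply: (dom e); rewrite inE.
  by case/cov/orP => /dom domz; [exists u|exists w];
    rewrite // ee !inE eqxx ?orbT.
have : ~~ blocks q M pb e by move: eF; rewrite inE eE (negPf eM).
case/not_blocksP => v ve /andP[sat /fintype.forall_inP dom]; exists v => //.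
rewrite /dominated sat; apply/fintype.forall_inP => f fN.
have [_ _ _ _ [up off]] := Hp' v; rewrite off //.
apply: le_trans (dom f fN) (up f _).
apply: contraTN fN => /(fintype.subsetP (edges_atS v XF)).
by rewrite !inE => /andP[/andP[/negPf -> _] _].
Qed.

(** Stability dominates every remaining edge at some endpoint, so the copies at which [p'] dominates
    form a cover, and each [p' v] is feasible for its program. *)
Lemma feasible_prefs_cover (R : realType) (V : finType) (E : {set {set V}})
    (q : V -> nat) (M : {set {set V}}) (p p' : prefs R V)
    (b : option (bounds R V)) (lam : V -> R) :
  let pb := clamp b p in
  let F := reduced_edges E q M pb in
  let X := [set x in copies F M | dominated q M p' x.1 x.2] in
  simple_graph E -> M \subset E -> (forall v, 0 <= lam v) ->
  feasible_prefs E q M b p' ->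
  vertex_cover F M X /\
  ((weighted_cost E lam p pb)%:E + cover_cost F q M b lam pb X <=
     (weighted_cost E lam p p')%:E)%E.
Proof.
move=> pb F X HE ME lam0 [p'b stab].
have FE : F \subset E := reduced_edgesS _ _ _ _.
have MF : M \subset F := sub_reduced_edges _ _ ME.
have XF : X \subset copies F M.
  by apply/fintype.subsetP => x; rewrite inE => /andP[].
split.
  split=> // [[u e] [w f]] /and3P[/= eFM /eqP ee /eqP fe].
  move: eFM; rewrite -ee in fe * => eFM; rewrite {f}fe.
  have eEM : e \in E :\: M.
    by move: eFM; rewrite !finset.in_setD => /andP[-> /(fintype.subsetP FE)].
  have /not_blocksP[v ve dom] := stab e eEM.
  have vX : (v, e) \in X.
    by rewrite inE dom andbT inE /= inE eFM ve.
  by move: ve; rewrite {1}ee finset.in_set2 => /orP[]/eqP <-; rewrite vX ?orbT.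
rewrite (weighted_cost_clamp _ _ HE p'b) EFinD leeD2l // -sumEFin.
rewrite /cover_cost /cost_on.
rewrite [leRHS](eq_bigl (mem [set: V])); last first.
  by move=> v; rewrite /= finset.in_setT.
apply: lee_sum => v _; rewrite /vertex_cost; case: eqP => [_|/eqP J0].
  by rewrite lee_fin LP_objective_ge0.
have dom e : e \in edges_at v X -> dominated q M p' v e.
  by rewrite inE => /[!inE] /andP[].
(* Domination includes saturation, which excludes the value [+oo] for an agent with a selected
   copy. *)
have [e /dom/andP[-> _]] := set0Pn _ J0.
apply: le_trans (LP_value_le lam pb _) _; last first.
  by rewrite lee_fin; apply: LP_objectiveS.
apply: (admissible_LP_feasible FE) => //
  [|e' f /dom/andP[_ /fintype.forall_inP]].
  exact: edges_atS.
by apply.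
Qed.

Lemma min_modification_cover (R : realType) (V : finType) (E : {set {set V}})
    (q : V -> nat) (M : {set {set V}}) (p : prefs R V)
    (b : option (bounds R V)) (lam : V -> R) :
  let pb := clamp b p in
  let F := reduced_edges E q M pb in
  simple_graph E -> M \subset E -> admissible E b pb ->
  (forall v, 0 <= lam v) ->
  min_modification_cost E q M b lam p =
    ((weighted_cost E lam p pb)%:E + min_cover_cost F q M b lam pb)%E.
Proof.
move=> pb F HE ME pbb lam0; apply/eqP; rewrite eq_le; apply/andP; split.
  (* The clamping cost is finite, so it can be moved across the inequality and each cover treated
     separately. *)
  rewrite -leeBlDl //; apply/ereal_infP => _ [X cov <-].
  have [->|cfin] := eqVneq (cover_cost F q M b lam pb X) +oo%E.
    exact: leey.
  rewrite leeBlDl //; rewrite -ltey in cfin.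
  have [p' [feas _ <-]] := cover_feasible_prefs HE ME pbb lam0 cov cfin.
  by apply: ereal_inf_lbound; exists p'.
apply/ereal_infP => _ [p' feas <-].
have [cov] := feasible_prefs_cover p HE ME lam0 feas.
apply: le_trans; rewrite leeD2l //.
apply: ereal_inf_lbound.
by exists [set x in copies F M | dominated q M p' x.1 x.2].
Qed.

(** The clamping cost W is nonnegative, so W + alpha C <= alpha (W + C) for [1 <= alpha], and the
    ratio survives adding W. *)
Lemma approx_cover_prefs (R : realType) (V : finType) (E : {set {set V}})
    (q : V -> nat) (M : {set {set V}}) (p : prefs R V)
    (b : option (bounds R V)) (lam : V -> R) (alpha : R)
    (X : {set V * {set V}}) :
  let pb := clamp b p in
  let F := reduced_edges E q M pb in
  simple_graph E -> M \subset E -> admissible E b pb ->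
  (forall v, 0 <= lam v) -> 1 <= alpha -> vertex_cover F M X ->
  (cover_cost F q M b lam pb X < +oo)%E ->
  (cover_cost F q M b lam pb X <= alpha%:E * min_cover_cost F q M b lam pb)%E ->
  exists p' : prefs R V,
    feasible_prefs E q M b p' /\
    ((weighted_cost E lam p p')%:E <=
       alpha%:E * min_modification_cost E q M b lam p)%E.
Proof.
move=> pb F HE ME pbb lam0 al1 cov cfin capprox.
have [p' [feas _ costE]] := cover_feasible_prefs HE ME pbb lam0 cov cfin.
exists p'; split=> //; rewrite costE min_modification_cover //.
have w0 : 0 <= weighted_cost E lam p pb.
  by apply: sumr_ge0 => v _; apply: sumr_ge0 => u _; rewrite mulr_ge0.
rewrite ge0_muleDr ?lee_fin //; last first.
  by apply/ereal_infP => _ [Y _ <-]; apply: cost_on_ge0.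
by rewrite leeD // -EFinM lee_fin ler_peMl.
Qed.

Theorem mainTheorem9 (R : realType) (V : finType) (E : {set {set V}})
  (q : V -> nat) (M : {set {set V}}) (p : prefs R V)
  (b : option (bounds R V)) (lam : V -> R)
  (HE : simple_graph E)
  (Hq : forall v, (0 < q v)%N)
  (HM : maximal_q_matching E q M)
  (Hp : forall v e, e \in incident E v -> 0 <= p v e)
  (Hb : bounds_ok E b)
  (Hlam : forall v, 0 <= lam v) :
  let pb := clamp b p in
  let E' := reduced_edges E q M pb in
  let c := cover_cost E' q M b lam pb in
  [/\ (* the optimum of LP_v is the minimum weighted cost of dominating J at v *)
      forall (v : V) (J : {set {set V}}),
        saturated q M v -> J \subset incident (E' :\: M) v ->
        LP_value E' M b lam pb v J = min_domination_cost E' M b lam pb q v J,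

      (* c is submodular *)
      submodular_on (copies E' M) c,

      (* the modification problem is equivalent to the minimum c-cost vertex
         cover problem in H, up to the constant cost of clamping p *)
      [/\ forall X : {set V * {set V}}, vertex_cover E' M X -> (c X < +oo)%E ->
            exists p' : prefs R V,
              [/\ feasible_prefs E q M b p',
                  forall v, LP_feasible E' M b v (edges_at v X) (p' v) &
                  (weighted_cost E lam p p')%:E =
                    ((weighted_cost E lam p pb)%:E + c X)%E],

          forall p' : prefs R V, feasible_prefs E q M b p' ->
            let X := [set x in copies E' M | dominated q M p' x.1 x.2] in
            vertex_cover E' M X /\
            ((weighted_cost E lam p pb)%:E + c X <=
               (weighted_cost E lam p p')%:E)%E,

          min_modification_cost E q M b lam p =
            ((weighted_cost E lam p pb)%:E +
               min_cover_cost E' q M b lam pb)%E &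

          (* in particular alpha-approximate covers (alpha = 1: optimal ones)
             give alpha-approximate preferences *)
          forall (alpha : R) (X : {set V * {set V}}), 1 <= alpha ->
            vertex_cover E' M X -> (c X < +oo)%E ->
            (c X <= alpha%:E * min_cover_cost E' q M b lam pb)%E ->
            exists p' : prefs R V,
              feasible_prefs E q M b p' /\
              ((weighted_cost E lam p p')%:E <=
                 alpha%:E * min_modification_cost E q M b lam p)%E] &

      (* if G is bipartite, then so is H, and c is the sum of two submodular
         functions, one on each side of H *)
      forall A : {set V}, bipartition E A ->
        [/\ forall x y, Hadj E' M x y -> (x.1 \in A) != (y.1 \in A),
            submodular_on (copies_on E' M A) (cost_on E' q M b lam pb A),
            submodular_on (copies_on E' M (~: A))
              (cost_on E' q M b lam pb (~: A)) &
            forall X : {set V * {set V}}, X \subset copies E' M ->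
              c X = (cost_on E' q M b lam pb A (X :&: copies_on E' M A) +
                     cost_on E' q M b lam pb (~: A)
                       (X :&: copies_on E' M (~: A)))%E]].
Proof.
move=> pb E' c.
have ME : M \subset E by case: HM => -[].
have pbb : admissible E b pb := clamp_admissible Hb Hp.
have E'E : E' \subset E := reduced_edgesS _ _ _ _.
have ME' : M \subset E' := sub_reduced_edges _ _ ME.
have pbb' : admissible E' b pb.
  by move=> v e ev; apply: pbb; apply: (fintype.subsetP (incidentS v E'E)).
have submod A (S : {set V * {set V}}) : S \subset copies E' M ->
    submodular_on S (cost_on E' q M b lam pb A).
  by move=> SC; apply: cost_on_submodular.
have onS A : copies_on E' M A \subset copies E' M.
  by apply/fintype.subsetP => x; rewrite inE => /andP[].
split.
- by move=> v J sat JE; apply: LP_value_domination.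
- exact: submod.
- split.
  + by move=> X cov cfin; exact: (cover_feasible_prefs HE ME pbb Hlam cov).
  + by move=> p' feas; exact: (feasible_prefs_cover p HE ME Hlam feas).
  + exact: (min_modification_cover q HE ME pbb Hlam).
  + move=> alpha X al1 cov cfin.
    exact: (approx_cover_prefs HE ME pbb Hlam al1 cov cfin).
- move=> A HA; split.
  + by move=> x y xy; apply: (Hadj_bipartition HE E'E HA xy).
  + exact/submod/onS.
  + exact/submod/onS.
  + by move=> X; apply: cover_cost_sides.
Qed.
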